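(* Let $\mathcal{K} = \mathcal{Q}^{t_1} \times \cdots \times \mathcal{Q}^{t_{r_1}} \times \mathcal{S}_+^{n_1} \times \cdots \times \mathcal{S}_+^{n_{r_2}}$ with $r_1+r_2>0$, $t_j\ge 3$ and $n_j\ge 3$ for every $j$. Consider the problem (D) with $c = 0$ and $\mathcal{A}$ such that $\mathrm{range}\, \mathcal{A}^* = \mathcal{L}$, where $\mathcal{L}^\perp$ is the subspace spanned by the following vectors: 1. $a^1_{1} + a^1_{2}$ and $a^{j-1}_3 + a^j_{1} + a^j_{2}$ for $1 < j \leq r_1$; 2. $a^{r_1}_3 + a^1_{1,1}$ and $a^{1}_{i,i} + a^{1}_{i-1,i+1}$ for $1 < i < n_1$ (if $r_1 = 0$, use $a^1_{1,1}$ instead of $a^{r_1}_3 + a^1_{1,1}$); 3. $a^{j-1}_{n_{j-1}-1,\,n_{j-1}} + a^j_{1,1}$ and $a^{j}_{i,i} + a^{j}_{i-1,i+1}$ for $1 < i < n_j$, for each $1 < j \leq r_2$. (Item 1 is omitted if $r_1=0$; items 2 and 3 are omitted if $r_2=0$.) Then $$d(D) = r_1 + \sum_{j = 1}^{r_2} (n_j - 1).$$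
   Context: $\mathcal{Q}^t=\{(x_0,\overline{x})\in\mathbb{R}\times\mathbb{R}^{t-1} : x_0\ge\|\overline{x}\|_2\}$ is the Lorentz cone and $\mathcal{S}_+^k$ is the cone of $k\times k$ symmetric positive semidefinite matrices. The ambient space is $\mathbb{R}^{t_1}\times\cdots\times\mathbb{R}^{t_{r_1}}\times\mathcal{S}^{n_1}\times\cdots\times\mathcal{S}^{n_{r_2}}$ with its standard inner product ($\mathcal{S}^k$: $k\times k$ symmetric matrices). For $1\le j\le r_1$, $a^j_i$ (one subscript) is the element of the ambient space all of whose blocks are zero except the block of $\mathcal{Q}^{t_j}$, which is the $i$-th unit vector (so $i=1$ is the $x_0$ coordinate). For $1\le j\le r_2$, $a^j_{i,k}$ (two subscripts) is the element all of whose blocks are zero except the block of $\mathcal{S}_+^{n_j}$, which is the matrix with ones at the entries $(i,k)$ and $(k,i)$ and zeros elsewhere. Problem (D) is $\sup\{\langle b,y\rangle : c-\mathcal{A}^*y\in\mathcal{K}\}$, where $\mathcal{A}$ is a linear map from the ambient space to $\mathbb{R}^m$ with adjoint $\mathcal{A}^*$ and $b\in\mathbb{R}^m$. Generic Facial Reduction: (1) Set $\mathcal{F}_1=\mathcal{K}$, $i=1$. (2) Let $d_i\in\mathcal{F}_i^*\cap\ker\mathcal{A}$ (dual cone $\mathcal{F}_i^*$) be such that either $d_i\notin\mathcal{F}_i^\perp$ and $\langle c,d_i\rangle=0$, or $\langle c,d_i\rangle<0$; if no such $d_i$ exists, the minimal face of $\mathcal{K}$ containing the feasible slacks $\{c-\mathcal{A}^*y\in\mathcal{K}\}$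 is $\mathcal{F}_i$; stop. (3) If $\langle c,d_i\rangle<0$, (D) is infeasible; stop. (4) Otherwise set $\mathcal{F}_{i+1}=\mathcal{F}_i\cap\{d_i\}^\perp$, increase $i$ by one, and return to (2). The output is the set of all directions found. The singularity degree $d(D)$ is the minimum number of directions among all possible outputs. *)

(* Defs.v *)
(* MathComp / MathComp-Analysis *)
From HB Require Import structures.
From mathcomp Require Import all_boot all_order all_algebra.
From mathcomp Require Import boolp classical_sets reals.

Set Implicit Arguments.
Unset Strict Implicit.
Unset Printing Implicit Defensive.

Import Order.TTheory GRing.Theory Num.Theory.

Local Open Scope classical_set_scope.
Local Open Scope ring_scope.

Section DependentProduct.
Variables (R : nzRingType) (I : finType) (V : I -> lmodType R).

Definition dprod : Type := {dffun forall i : I, V i}.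
HB.instance Definition _ := Choice.on dprod.

Implicit Types x y z : dprod.

Definition dprod_zero : dprod := [ffun i : I => 0 : V i].
Definition dprod_opp x : dprod := [ffun i : I => - x i : V i].
Definition dprod_add x y : dprod := [ffun i : I => x i + y i : V i].
Definition dprod_scale (a : R) x : dprod := [ffun i : I => a *: x i : V i].

Fact dprod_addA : associative dprod_add.
Proof. by move=> x y z; apply/ffunP => i; rewrite !ffunE addrA. Qed.
Fact dprod_addC : commutative dprod_add.
Proof. by move=> x y; apply/ffunP => i; rewrite !ffunE addrC. Qed.
Fact dprod_add0 : left_id dprod_zero dprod_add.
Proof. by move=> x; apply/ffunP => i; rewrite !ffunE add0r. Qed.
Fact dprod_addN : left_inverse dprod_zero dprod_opp dprod_add.
Proof. by move=> x; apply/ffunP => i; rewrite !ffunE addNr. Qed.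

HB.instance Definition _ := GRing.isZmodule.Build dprod
  dprod_addA dprod_addC dprod_add0 dprod_addN.

Fact dprod_scaleA a b x :
  dprod_scale a (dprod_scale b x) = dprod_scale (a * b) x.
Proof. by apply/ffunP => i; rewrite !ffunE scalerA. Qed.
Fact dprod_scale1 : left_id 1 dprod_scale.
Proof. by move=> x; apply/ffunP => i; rewrite !ffunE scale1r. Qed.
Fact dprod_scaleDr : right_distributive dprod_scale +%R.
Proof. by move=> a x y; apply/ffunP => i; rewrite !ffunE scalerDr. Qed.
Fact dprod_scaleDl x : {morph dprod_scale^~ x : a b / a + b}.
Proof. by move=> a b; apply/ffunP => i; rewrite !ffunE scalerDl. Qed.

HB.instance Definition _ := GRing.Zmodule_isLmodule.Build R dprod
  dprod_scaleA dprod_scale1 dprod_scaleDr dprod_scaleDl.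

Lemma dprod_zeroE i : (0 : dprod) i = 0.
Proof. by rewrite ffunE. Qed.
Lemma dprod_oppE x i : (- x) i = - x i.
Proof. by rewrite ffunE. Qed.
Lemma dprod_addE x y i : (x + y) i = x i + y i.
Proof. by rewrite ffunE. Qed.
Lemma dprod_scaleE a x i : (a *: x) i = a *: x i.
Proof. by rewrite ffunE. Qed.

End DependentProduct.

Section SymmetricMatrices.
Variables (R : realType) (k : nat).

Definition symmetric_pred : pred 'M[R]_k := fun M => M \is symmetricmx.

Lemma symmetric_predP M : reflect (M^T = M) (symmetric_pred M).
Proof.
rewrite /symmetric_pred is_hermitianmxE expr0 scale1r map_mx_id // eq_sym.
exact: eqP.
Qed.

Fact symmetric_submod_closed : submod_closed symmetric_pred.
Proof.
split=> [|a M N /symmetric_predP hM /symmetric_predP hN].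
  by apply/symmetric_predP; rewrite trmx0.
by apply/symmetric_predP; rewrite linearP /= hM hN.
Qed.

HB.instance Definition _ := GRing.isSubmodClosed.Build R 'M[R]_k symmetric_pred
  symmetric_submod_closed.

Record symmx := SymMx { symval :> 'M[R]_k; _ : symmetric_pred symval }.

HB.instance Definition _ := [isSub for symval].
HB.instance Definition _ := [Choice of symmx by <:].
HB.instance Definition _ := [SubChoice_isSubLmodule of symmx by <:].

End SymmetricMatrices.

Definition dotv (R : realType) (k : nat) (u v : 'rV[R]_k) : R :=
  \sum_(i < k) u 0 i * v 0 i.

(* The coordinate x_0 is the one of index 0 : 'I_k. *)
Definition lorentz (R : realType) (k : nat) : set 'rV[R]_k :=
  [set x | exists2 i0 : 'I_k, i0 = 0%N :> nat &
           Num.sqrt (\sum_(i < k | i != i0) x 0 i ^+ 2) <= x 0 i0].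

Definition psd (R : realType) (k : nat) : set (symmx R k) :=
  [set X | forall v : 'cV[R]_k, 0 <= (v^T *m (X : 'M[R]_k) *m v) 0 0].

(* Unit vectors and elementary symmetric matrices are indexed from 1. *)
Definition unit_vec (R : realType) (k i : nat) : 'rV[R]_k :=
  \row_(p < k) (p.+1 == i)%:R.

Definition elem_mx (R : realType) (k i l : nat) : 'M[R]_k :=
  \matrix_(p < k, q < k)
    (((p.+1 == i) && (q.+1 == l)) || ((p.+1 == l) && (q.+1 == i)))%:R.

Lemma elem_mx_symmetric (R : realType) (k i l : nat) :
  symmetric_pred (elem_mx R k i l).
Proof.
apply/symmetric_predP/matrixP => p q; rewrite !mxE.
by rewrite orbC ![(q.+1 == _) && _]andbC.
Qed.

Definition elem_symmx (R : realType) (k i l : nat) : symmx R k :=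
  SymMx (elem_mx_symmetric R k i l).

Section ConicProblem.
Variables (R : realType) (r1 r2 : nat).
Variables (t : 'I_r1 -> nat) (n : 'I_r2 -> nat).

Definition ambient : lmodType R :=
  (dprod (fun j : 'I_r1 => 'rV[R]_(t j) : lmodType R) *
   dprod (fun j : 'I_r2 => symmx R (n j) : lmodType R))%type.

Definition ip (x y : ambient) : R :=
  \sum_(j < r1) dotv (x.1 j) (y.1 j) +
  \sum_(j < r2) \tr ((x.2 j : 'M[R]_(n j)) *m (y.2 j : 'M[R]_(n j))).

Definition prod_cone : set ambient :=
  [set x : ambient | (forall j : 'I_r1, lorentz (x.1 j)) /\
                     (forall j : 'I_r2, psd (x.2 j))].

Definition lin_span (S : set ambient) : set ambient :=
  [set x | exists (k : nat) (a : 'I_k -> R) (v : 'I_k -> ambient),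
     (forall i, S (v i)) /\ x = \sum_(i < k) a i *: v i].

Definition perp (S : set ambient) : set ambient :=
  [set d | forall x, S x -> ip d x = 0].

Definition dual_cone (S : set ambient) : set ambient :=
  [set d | forall x, S x -> 0 <= ip d x].

(* The data of  sup { <b, y> : c - A^* y \in prod_cone }. *)
Record dual_problem := DualProblem {
  dp_dim : nat;
  dp_A : {linear ambient -> 'rV[R]_dp_dim};
  dp_Astar : {linear 'rV[R]_dp_dim -> ambient};
  dp_adjoint : forall x y, dotv (dp_A x) y = ip x (dp_Astar y);
  dp_b : 'rV[R]_dp_dim;
  dp_c : ambient }.

Section FacialReduction.
Variable P : dual_problem.

Definition reducing (F : set ambient) (d : ambient) : Prop :=
  [/\ dual_cone F d, dp_A P d = 0, ~ perp F d & ip (dp_c P) d = 0].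

Definition infeasibility_certificate (F : set ambient) (d : ambient) : Prop :=
  [/\ dual_cone F d, dp_A P d = 0 & ip (dp_c P) d < 0].

(* [fr_output F ds]: starting from the face F, facial reduction may find
   successively the directions ds and then terminate.  The directions of a run
   are pairwise distinct, so their number is [size ds]. *)
Inductive fr_output : set ambient -> seq ambient -> Prop :=
| FrStop F :
    (forall d, ~ (reducing F d \/ infeasibility_certificate F d)) ->
    fr_output F [::]
| FrInfeasible F d :
    infeasibility_certificate F d -> fr_output F [:: d]
| FrReduce F d ds :
    reducing F d -> fr_output (F `&` perp [set d]) ds ->
    fr_output F (d :: ds).

Definition is_singularity_degree (k : nat) : Prop :=
  (exists2 ds, fr_output prod_cone ds & size ds = k) /\
  (forall ds, fr_output prod_cone ds -> (k <= size ds)%N).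

End FacialReduction.

Definition aQ (j : 'I_r1) (i : nat) : ambient :=
  ([ffun j' : 'I_r1 => if j' == j then unit_vec R (t j') i else 0], 0).

Definition aS (j : 'I_r2) (i k : nat) : ambient :=
  (0, [ffun j' : 'I_r2 => if j' == j then elem_symmx R (n j') i k else 0]).

(* Blocks are indexed from 0 by ordinals, coordinates inside a block from 1. *)
Inductive generator : set ambient :=
| GenQ1 (j : 'I_r1) :
    j = 0%N :> nat -> generator (aQ j 1 + aQ j 2)
| GenQ (j' j : 'I_r1) :
    j = j'.+1 :> nat -> generator (aQ j' 3 + (aQ j 1 + aQ j 2))
| GenQS (j' : 'I_r1) (j : 'I_r2) :
    j'.+1 = r1 -> j = 0%N :> nat -> generator (aQ j' 3 + aS j 1 1)
| GenS1 (j : 'I_r2) :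
    r1 = 0%N -> j = 0%N :> nat -> generator (aS j 1 1)
| GenSS (j' j : 'I_r2) :
    j = j'.+1 :> nat ->
    generator (aS j' (n j' - 1)%N (n j') + aS j 1 1)
| GenS (j : 'I_r2) (i : nat) :
    (1 < i < n j)%N -> generator (aS j i i + aS j (i - 1)%N i.+1).

End ConicProblem.

(* Main.v *)
(** The generators form a chain: each one is a head plus the tail of its
    predecessor, where a head is nonnegative on the cone and vanishes only where
    its own tail vanishes.  So, taken in order, the generators are reducing
    directions.  Conversely, on the face cut out by the first [k] generators, an
    element of the span lying in the dual cone has no component on the
    generators after the next one: in a block such a component would be an
    off-diagonal entry of a positive semidefinite matrix sitting next to a zero
    diagonal entry, or the analogue for the Lorentz cone.  Every facial
    reduction is therefore forced to cut out the same chain of faces, one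
    generator at a time, and all runs have the same length. *)
Require Import Defs.
From mathcomp Require Import all_boot all_order all_algebra.
From mathcomp Require Import boolp classical_sets reals.
From mathcomp Require Import ring lra zify.

Set Implicit Arguments.
Unset Strict Implicit.
Unset Printing Implicit Defensive.

Import Order.TTheory GRing.Theory Num.Theory.

Local Open Scope classical_set_scope.
Local Open Scope ring_scope.

(** * The inner product of the ambient space and the kernel of [dp_A] *)

Section InnerProduct.
Variables (R : realType) (r1 r2 : nat).
Variables (t : 'I_r1 -> nat) (n : 'I_r2 -> nat).
Implicit Types (x y z d : ambient R t n) (a : R).

Lemma ipC x y : ip x y = ip y x.
Proof.
rewrite /ip; congr (_ + _); apply: eq_bigr => j _; last exact: mxtrace_mulC.
by apply: eq_bigr => i _; rewrite mulrC.
Qed.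

Lemma ipDl x y z : ip (x + y) z = ip x z + ip y z.
Proof.
rewrite /ip addrACA -!big_split; congr (_ + _); apply: eq_bigr => j _ /=.
  rewrite /dotv -big_split; apply: eq_bigr => i _ /=.
  by rewrite dprod_addE mxE mulrDl.
by rewrite dprod_addE /= mulmxDl linearD.
Qed.

Lemma ipZl a x y : ip (a *: x) y = a * ip x y.
Proof.
rewrite /ip mulrDr !mulr_sumr; congr (_ + _); apply: eq_bigr => j _ /=.
  rewrite /dotv mulr_sumr; apply: eq_bigr => i _ /=.
  by rewrite dprod_scaleE mxE mulrA.
by rewrite dprod_scaleE /= -scalemxAl linearZ.
Qed.

Lemma ip0l x : ip 0 x = 0.
Proof. by rewrite -(scale0r x) ipZl mul0r. Qed.

Lemma ip_sumZ (I : finType) (al : I -> R) (G : I -> ambient R t n) x :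
  ip (\sum_i al i *: G i) x = \sum_i al i * ip (G i) x.
Proof.
apply: (big_rec2 (fun u v => ip u x = v)); first exact: ip0l.
by move=> i u v _ <-; rewrite ipDl ipZl.
Qed.

Lemma dp_kerP (P : dual_problem R t n) d :
  dp_A P d = 0 <-> perp (range (dp_Astar P)) d.
Proof.
split=> [Ad0 _ [y _ <-]|dperp].
  rewrite -dp_adjoint Ad0 /dotv big1 // => i _.
  by rewrite mxE mul0r.
(* Pairing [d] with [dp_Astar P (dp_A P d)] gives the squared norm of [dp_A P d]. *)
have: dotv (dp_A P d) (dp_A P d) = 0 by rewrite dp_adjoint dperp.
move/psumr_eq0P => sq0; apply/rowP => i; rewrite mxE; apply/eqP.
by rewrite -sqrf_eq0 expr2 sq0 // => k _; rewrite -expr2 sqr_ge0.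
Qed.

End InnerProduct.

Lemma quadratic_ge0_lin (R : realType) (u v : R) :
  (forall s, 0 <= u * s ^+ 2 + v * s) -> v = 0.
Proof.
move=> ge0; apply/eqP/negPn/negP => v0.
have u1 : 0 < 1 + `|u| by rewrite ltr_pwDl.
(* The denominator is positive and exceeds [u] whatever its sign, so the value at this [s] is
   negative. *)
have := ge0 (- v / (1 + `|u|)).
have -> : u * (- v / (1 + `|u|)) ^+ 2 + v * (- v / (1 + `|u|)) =
  (v / (1 + `|u|)) ^+ 2 * (u - (1 + `|u|)).
  by field; rewrite gt_eqF.
have s0 : 0 < (v / (1 + `|u|)) ^+ 2.
  by rewrite exprn_even_gt0 //= mulf_neq0 ?invr_neq0 // gt_eqF.
by rewrite pmulr_rge0 // subr_ge0 leNgt (le_lt_trans (ler_norm u)) // ltrDr.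
Qed.

(** * Facial reduction along an abstract chain of heads and tails *)

Section FacialChain.
Variables (R : realType) (r1 r2 : nat).
Variables (t : 'I_r1 -> nat) (n : 'I_r2 -> nat) (P : dual_problem R t n).
Hypothesis c_eq0 : dp_c P = 0.

Variables (N : nat) (I : finType) (rank : I -> nat).
Hypothesis rank_inj : injective rank.
Hypothesis rank_lt : forall a, (rank a < N)%N.
Hypothesis rank_surj : forall k, (k < N)%N -> exists a, rank a = k.

Variables head tail : I -> ambient R t n.

(* The sum has at most one term, since [rank] is injective. *)
Definition link (b : I) : ambient R t n :=
  head b + \sum_(a | rank b == (rank a).+1) tail a.

Hypothesis ker_span : forall d,
  dp_A P d = 0 <-> exists al : I -> R, d = \sum_a al a *: link a.

Hypothesis head_ge0 : forall a x, prod_cone x -> 0 <= ip (head a) x.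
Hypothesis tail_eq0 : forall a x,
  prod_cone x -> ip (head a) x = 0 -> ip (tail a) x = 0.
(** The point is invisible to earlier labels, and its tail takes any value [s] of either sign at the
    cost of only [s ^+ 2] in the head. *)
Hypothesis test_point : forall a s, exists x : ambient R t n,
  [/\ prod_cone x, ip (head a) x = s ^+ 2, ip (tail a) x = s,
      forall c, (rank c < rank a)%N -> ip (head c) x = 0 /\ ip (tail c) x = 0 &
      forall c, rank c = (rank a).+1 -> ip (head c) x = 0].

Definition chain_face (k : nat) : set (ambient R t n) :=
  [set x | prod_cone x /\ forall a, (rank a < k)%N -> ip (link a) x = 0].

Lemma link_first b : rank b = 0%N -> link b = head b.
Proof. by move=> b0; rewrite /link big_pred0 ?addr0 // => a; rewrite b0. Qed.

Lemma link_next a b : rank b = (rank a).+1 -> link b = head b + tail a.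
Proof.
move=> ba; rewrite /link (big_pred1 a) // => c.
by rewrite ba eqSS eq_sym (inj_eq rank_inj).
Qed.

Lemma ip_link a x :
    (forall c, rank a = (rank c).+1 -> ip (tail c) x = 0) ->
  ip (link a) x = ip (head a) x.
Proof.
move=> tail0; rewrite /link ipDl -[RHS]addr0; congr (_ + _).
apply: (big_rec (fun u => ip u x = 0)); first exact: ip0l.
by move=> c u /eqP /tail0 h e; rewrite ipDl h e addr0.
Qed.

(** Strong induction on the rank: once the head of the predecessor vanishes at [x], so does its
    tail, and the link agrees there with its own head. *)
Lemma chain_face_head k x : chain_face k x ->
  forall a, (rank a < k)%N -> ip (head a) x = 0.
Proof.
case=> Kx x0 a; have [m] := ubnP (rank a).
elim: m a => // m IH a am ak.
rewrite -ip_link ?x0 // => c ac; apply: tail_eq0 => //; apply: IH.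
  by rewrite ac ltnS in am.
by rewrite (ltn_trans _ ak) // ac.
Qed.

Lemma link_ge0 a x : chain_face (rank a) x -> 0 <= ip (link a) x.
Proof.
move=> Fx; have [Kx _] := Fx; rewrite ip_link ?head_ge0 // => c ac.
by apply: tail_eq0 => //; apply: (chain_face_head Fx); rewrite ac.
Qed.

Lemma link_test a s : exists x,
  [/\ chain_face (rank a) x, ip (link a) x = s ^+ 2 &
      forall b, rank b = (rank a).+1 -> ip (link b) x = s].
Proof.
have [x [Kx xa xt before after]] := test_point a s; exists x; split.
- split=> // c ca; rewrite ip_link; first by have [] := before c ca.
  move=> e ce; suff /before[] : (rank e < rank a)%N by [].
  by rewrite (ltn_trans _ ca) // ce.
- by rewrite ip_link // => c ac; have [|] := before c; rewrite ?ac.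
- by move=> b ba; rewrite (link_next ba) ipDl after // add0r.
Qed.

(** On this face [d] acts as a nonzero multiple of [link a], so both have the same zero set
    there. *)
Lemma chain_faceS a d (al : R) :
    al != 0 ->
    (forall x, chain_face (rank a) x -> ip d x = al * ip (link a) x) ->
  chain_face (rank a) `&` perp [set d] = chain_face (rank a).+1.
Proof.
move=> al0 dE; apply/seteqP; split=> x.
  case=> Fx /(_ d erefl); rewrite ipC dE // => /eqP.
  rewrite mulf_eq0 (negPf al0) /= => /eqP xa.
  case: Fx => Kx x0; split=> // c; rewrite ltnS leq_eqVlt => /orP[/eqP|/x0//].
  by move=> /rank_inj ->.
case=> Kx x0; have Fx : chain_face (rank a) x.
  by split=> // c ca; rewrite x0 // ltnW.
by split=> // _ ->; rewrite ipC dE // x0 ?mulr0.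
Qed.

(* Descending induction on the rank of [b]: once all later coefficients vanish,
   pairing with the test points of the predecessor of [b] leaves the quadratic
   [al a * s ^+ 2 + al b * s], which is nonnegative for all [s]. *)
Lemma dual_face_coef k d (al : I -> R) :
    dual_cone (chain_face k) d -> d = \sum_a al a *: link a ->
  forall b, (k < rank b)%N -> al b = 0.
Proof.
move=> dual dE b; have [m] := ubnP (N - rank b)%N.
elim: m b => // m IH b bm kb.
have [a ab] : exists a, rank b = (rank a).+1.
  have [|a ak] := rank_surj (k := (rank b).-1); first by have := rank_lt b; lia.
  by exists a; lia.
apply: (@quadratic_ge0_lin _ (al a)) => s.
have [x [[Kx x0] xa xb]] := link_test a s.
have Fx : chain_face k x by split=> // c ck; apply: x0; lia.
have := dual x Fx; rewrite dE ip_sumZ (bigD1 a) //= (bigD1 b) /=; last first.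
  by apply/eqP => ba; move: ab; rewrite ba; lia.
rewrite xa xb // big1 ?addr0 // => c /andP[ca cb].
have [|ac|/rank_inj e] := ltngtP (rank c) (rank a).
- by move=> /x0 ->; rewrite mulr0.
- have := cb; rewrite -(inj_eq rank_inj) => /eqP cb'.
  rewrite IH ?mul0r //; have := rank_lt c; lia.
- by rewrite e eqxx in ca.
Qed.

(** Earlier links vanish on the face and later ones have coefficient zero in [d], so [d] acts there
    as a multiple of the link of rank [k], nonzero because [d] is not orthogonal to the face. *)
Lemma reducing_step k d : reducing P (chain_face k) d ->
  (k < N)%N /\ chain_face k `&` perp [set d] = chain_face k.+1.
Proof.
case=> dual /ker_span[al dE] nperp _.
have al0 := dual_face_coef dual dE.
have [kN|Nk] := ltnP k N; last first.
  (* With [k] at least [N], every link vanishes on the face, so no [d] in the kernel is reducing. *)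
  case: nperp => x [_ x0]; rewrite dE ip_sumZ big1 // => a _.
  by rewrite x0 ?mulr0 // (leq_trans (rank_lt a)).
have [a ak] := rank_surj kN; split=> //.
have ipd x : chain_face k x -> ip d x = al a * ip (link a) x.
  case=> _ x0; rewrite dE ip_sumZ (bigD1 a) //= big1 ?addr0 // => c ca.
  have [/x0 ->|/al0 ->|e] := ltngtP (rank c) k; rewrite ?mulr0 ?mul0r //.
  by move: ca; rewrite -(inj_eq rank_inj) ak e eqxx.
rewrite -ak; apply: (@chain_faceS a d (al a)); last by rewrite ak.
apply/negP => /eqP ala; apply: nperp => x Fx.
by rewrite ipd // ala mul0r.
Qed.

Lemma reducing_link a : reducing P (chain_face (rank a)) (link a).
Proof.
split.
- by move=> x; apply: link_ge0.
- apply/ker_span; exists (fun c => (c == a)%:R).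
  rewrite (bigD1 a) //= eqxx scale1r big1 ?addr0 // => c /negPf ->.
  by rewrite scale0r.
(* The test point with [s = 1] pairs to 1, so the link is not orthogonal to the face. *)
- have [x [Fx xa _]] := link_test a 1 => /(_ x Fx) /eqP.
  by rewrite xa expr1n oner_eq0.
- by rewrite c_eq0 ip0l.
Qed.

Lemma no_certificate F d : ~ infeasibility_certificate P F d.
Proof. by case=> _ _; rewrite c_eq0 ip0l ltxx. Qed.

(** A run cannot stop while [k < N], since the link of rank [k] is still reducing, and each
    direction raises [k] by exactly one. *)
Lemma fr_output_size F ds : fr_output P F ds ->
  forall k, (k <= N)%N -> F = chain_face k -> size ds = (N - k)%N.
Proof.
elim=> {F ds} [F stop|F d cert|F d ds red _ IH] k kN FE.
- have [/rank_surj[a ak]|] := ltnP k N; last by rewrite -subn_eq0 => /eqP.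
  case: (stop (link a)); left; rewrite FE -ak; exact: reducing_link.
- by case: (no_certificate cert).
- move: red; rewrite FE => /reducing_step[kN' FS] /=.
  by rewrite (IH k.+1) ?FE // subnSK.
Qed.

Lemma fr_output_exists k : (k <= N)%N ->
  exists ds, fr_output P (chain_face k) ds.
Proof.
have [m] := ubnP (N - k); elim: m k => // m IH k km kN.
have [/[dup] kN' /rank_surj[a ak]|Nk] := ltnP k N.
  have [||ds dsP] := IH k.+1; [lia|lia|].
  have red : reducing P (chain_face k) (link a).
    by rewrite -ak; exact: reducing_link.
  exists (link a :: ds); apply: FrReduce => //.
  by have [_ ->] := reducing_step red.
exists [::]; apply: FrStop => d [/reducing_step[]|/no_certificate//].
by rewrite ltnNge Nk.
Qed.

Lemma chain_singularity_degree : is_singularity_degree P N.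
Proof.
have K0 : prod_cone (t := t) (n := n) = chain_face 0.
  by apply/seteqP; split=> x //; case.
rewrite /is_singularity_degree K0; split=> [|ds dsP].
  have [ds dsP] := fr_output_exists (leq0n N).
  by exists ds => //; rewrite (fr_output_size dsP (leq0n N)) ?subn0.
by rewrite (fr_output_size dsP (leq0n N)) ?subn0.
Qed.

End FacialChain.

(** * Coordinates, head and tail inequalities within one block, and test points *)

Section Blocks.
Variables (R : realType) (r1 r2 : nat).
Variables (t : 'I_r1 -> nat) (n : 'I_r2 -> nat).
Implicit Types (x : ambient R t n).

Lemma ip_aQ x (j : 'I_r1) (p : 'I_(t j)) :
  ip (aQ R t n j p.+1) x = x.1 j 0 p.
Proof.
rewrite /ip (bigD1 j) //= big1 ?addr0; last first.
  move=> k /negPf kj; rewrite /dotv big1 // => i _.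
  by rewrite ffunE kj mxE mul0r.
rewrite [X in _ + X]big1 ?addr0; last first.
  by move=> k _; rewrite dprod_zeroE mul0mx mxtrace0.
rewrite /dotv (bigD1 p) //= ffunE eqxx mxE eqxx mul1r big1 ?addr0 // => i ip.
by rewrite mxE eqSS (inj_eq val_inj) (negPf ip) mul0r.
Qed.

Lemma symmxE (k : nat) (X : symmx R k) p q : (X : 'M_k) p q = (X : 'M_k) q p.
Proof.
by case: X => M /= /symmetric_predP MT; rewrite -[in LHS]MT mxE.
Qed.

Lemma elem_mxE (k : nat) (p q : 'I_k) :
  elem_mx R k p.+1 q.+1 =
  if p == q then delta_mx p p else delta_mx p q + delta_mx q p.
Proof.
apply/matrixP => i l; rewrite mxE !eqSS !(inj_eq val_inj).
case: (eqVneq p q) => [<-|pq]; rewrite !mxE; first by rewrite orbb.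
case: (eqVneq i p) => [->|]; case: (eqVneq l q) => [->|] //=;
  rewrite ?(negPf pq) ?[q == p]eq_sym ?(negPf pq) ?addr0 ?add0r //=.
Qed.

Lemma trace_delta_mul (k : nat) (X : 'M[R]_k) p q :
  \tr (delta_mx p q *m X) = X q p.
Proof.
rewrite /mxtrace (bigD1 p) //= big1 ?addr0; last first.
  by move=> i ip; rewrite mxE big1 // => l _; rewrite mxE (negPf ip) mul0r.
rewrite mxE (bigD1 q) //= mxE !eqxx mul1r big1 ?addr0 // => l lq.
by rewrite mxE (negPf lq) andbF mul0r.
Qed.

(** An off-diagonal elementary matrix has two ones, hence the factor 2. *)
Lemma ip_aS x (j : 'I_r2) (p q : 'I_(n j)) :
  ip (aS R t n j p.+1 q.+1) x =
  (x.2 j : 'M_(n j)) p q *+ (if p == q then 1 else 2).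
Proof.
rewrite /ip big1 ?add0r; last first.
  by move=> k _; rewrite /dotv big1 // => i _; rewrite dprod_zeroE mxE mul0r.
rewrite (bigD1 j) //= big1 ?addr0; last first.
  by move=> k /negPf kj; rewrite ffunE kj mul0mx mxtrace0.
rewrite ffunE eqxx /= elem_mxE; case: eqP => [<-|_].
  by rewrite trace_delta_mul.
by rewrite mulmxDl linearD /= !trace_delta_mul symmxE.
Qed.

(** Since [x_q^2 + x_r^2 <= x_p^2], the equality [x_q = - x_p] leaves no room for [x_r]. *)
Lemma lorentz_head_tail (k : nat) (x : 'rV[R]_k) (p q r : 'I_k) :
    p = 0%N :> nat -> q = 1%N :> nat -> r = 2%N :> nat -> lorentz x ->
  0 <= x 0 p + x 0 q /\ (x 0 p + x 0 q = 0 -> x 0 r = 0).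
Proof.
move=> p0 q1 r2' [i0 i00].
have -> : i0 = p by apply: val_inj; rewrite /= p0 i00.
set S := (X in Num.sqrt X) => Sx; have S_ge : x 0 q ^+ 2 + x 0 r ^+ 2 <= S.
  rewrite /S (bigD1 q) /=; last by apply/eqP => /(congr1 val) /=; lia.
  rewrite (bigD1 r) /=; last first.
    by apply/andP; split; apply/eqP => /(congr1 val) /=; lia.
  by rewrite addrA lerDl sumr_ge0 // => i _; rewrite sqr_ge0.
have S0 : 0 <= S by apply: le_trans S_ge; rewrite addr_ge0 ?sqr_ge0.
have xp0 : 0 <= x 0 p := le_trans (sqrtr_ge0 S) Sx.
have SE : S <= x 0 p ^+ 2.
  by rewrite -[S]sqr_sqrtr // ler_sqr ?nnegrE ?sqrtr_ge0.
split=> [|pq]; first by nra.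
apply/eqP; rewrite -sqrf_eq0 eq_le sqr_ge0 andbT.
by have xq : x 0 q = - x 0 p by [lra]; move: S_ge; rewrite xq; nra.
Qed.

(** Evaluate the form on [a e_p + b e_q]. With a zero diagonal entry and [a = 1] it is a polynomial
    in [b] without constant term, so its linear coefficient vanishes. *)
Lemma psd_diag_offdiag (k : nat) (X : symmx R k) (p q : 'I_k) : psd X ->
  0 <= (X : 'M_k) p p /\ ((X : 'M_k) p p = 0 -> (X : 'M_k) p q = 0).
Proof.
move=> psdX; have quad a b : 0 <= a ^+ 2 * (X : 'M_k) p p +
    (a * b * (X : 'M_k) p q) *+ 2 + b ^+ 2 * (X : 'M_k) q q.
  have := psdX (a *: delta_mx p 0 + b *: delta_mx q 0).
  have entry i l : ((delta_mx 0 i : 'rV_k) *m (X : 'M_k) *m 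
      (delta_mx l 0 : 'cV_k)) 0 0 = (X : 'M_k) i l.
    by rewrite -mulmxA -colE -rowE !mxE.
  have addE (A B : 'M[R]_1) : (A + B) 0 0 = A 0 0 + B 0 0 by rewrite mxE.
  have scaleE c (A : 'M[R]_1) : (c *: A) 0 0 = c * A 0 0 by rewrite mxE.
  rewrite [(_ + _)^T]linearD /= ![(_ *: _)^T]linearZ /= !trmx_delta.
  rewrite !mulmxDl !mulmxDr -!scalemxAl -!scalemxAr !(addE, scaleE) !entry.
  by rewrite [(X : 'M_k) q p]symmxE; congr (0 <= _); ring.
split=> [|Xpp]; first by have := quad 1 0; lra.
suff : (X : 'M_k) p q *+ 2 = 0 by lra.
apply: (@quadratic_ge0_lin _ ((X : 'M_k) q q)) => s.
by have := quad 1 s; rewrite Xpp; lra.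
Qed.

(** [f] is indexed by [nat], from 0, so that one function fits blocks of every size. *)
Definition pointQ (j : 'I_r1) (f : nat -> R) : ambient R t n :=
  ([ffun j' : 'I_r1 => if j' == j then \row_(i < t j') f i else 0], 0).

Lemma outer_symmetric (k : nat) (f : nat -> R) :
  symmetric_pred (\matrix_(p < k, q < k) (f p * f q)).
Proof. by apply/symmetric_predP/matrixP => p q; rewrite !mxE mulrC. Qed.

Definition pointS (j : 'I_r2) (f : nat -> R) : ambient R t n :=
  (0, [ffun j' : 'I_r2 =>
         if j' == j then SymMx (outer_symmetric (n j') f) else 0]).

Lemma ip_aQ_pointQ j i j' f : (i < t j)%N ->
  ip (aQ R t n j i.+1) (pointQ j' f) = if j == j' then f i else 0.
Proof.
move=> it; rewrite (ip_aQ _ (Ordinal it)) ffunE.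
by case: ifP => _; rewrite mxE.
Qed.

Lemma ip_aS_pointQ j i l j' f : (i < n j)%N -> (l < n j)%N ->
  ip (aS R t n j i.+1 l.+1) (pointQ j' f) = 0.
Proof.
move=> ij lj; rewrite (ip_aS _ (Ordinal ij) (Ordinal lj)) dprod_zeroE.
by rewrite mxE mul0rn.
Qed.

Lemma ip_aQ_pointS j i j' f : (i < t j)%N ->
  ip (aQ R t n j i.+1) (pointS j' f) = 0.
Proof. by move=> it; rewrite (ip_aQ _ (Ordinal it)) dprod_zeroE mxE. Qed.

Lemma ip_aS_pointS j i l j' f : (i < n j)%N -> (l < n j)%N ->
  ip (aS R t n j i.+1 l.+1) (pointS j' f) =
  if j == j' then (f i * f l) *+ (if i == l then 1 else 2) else 0.
Proof.
move=> ij lj; rewrite (ip_aS _ (Ordinal ij) (Ordinal lj)) ffunE.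
by case: ifP => _; rewrite mxE ?mul0rn.
Qed.

(** A block of size 0 has no coordinate [x_0], so its cone is empty as encoded. *)
Lemma lorentz0 k : (0 < k)%N -> lorentz (0 : 'rV[R]_k).
Proof.
move=> k0; exists (Ordinal k0) => //; rewrite big1 ?sqrtr0 ?mxE // => i _.
by rewrite mxE expr0n.
Qed.

Lemma psd0 k : psd (0 : symmx R k).
Proof. by move=> v; rewrite mulmx0 mul0mx mxE. Qed.

Hypothesis t_gt0 : forall j, (0 < t j)%N.

Lemma pointS_cone j f : prod_cone (pointS j f).
Proof.
split=> k; first by rewrite dprod_zeroE; exact: lorentz0.
rewrite ffunE; case: eqP => _; last exact: psd0.
move=> v; rewrite /=; set u := \row_(p < n k) f p.
have -> : \matrix_(p < n k, q < n k) (f p * f q) = u^T *m u.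
  by apply/matrixP => p q; rewrite !mxE big_ord1 !mxE.
rewrite mulmxA -trmx_mul -mulmxA.
by rewrite mxE big_ord1 mxE -expr2 sqr_ge0.
Qed.

Lemma pointQ_cone j f : 0 <= f 0%N ->
  \sum_(i < t j | (0 < i)%N) f i ^+ 2 <= f 0%N ^+ 2 -> prod_cone (pointQ j f).
Proof.
move=> f0 f_le; split=> k; last by rewrite dprod_zeroE; exact: psd0.
rewrite ffunE; case: eqP => [->|_]; last exact: lorentz0.
exists (Ordinal (t_gt0 j)) => //.
rewrite mxE /= -[f 0%N]ger0_norm // -sqrtr_sqr.
rewrite ler_sqrt ?sqr_ge0 //; apply: le_trans f_le.
rewrite le_eqVlt; apply/orP; left; apply/eqP.
by apply: eq_big => i; rewrite ?mxE // -(inj_eq val_inj) lt0n.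
Qed.

End Blocks.

(** * The generators as links of a chain of labels *)

Section Generators.
Variables (R : realType) (r1 r2 : nat).
Variables (t : 'I_r1 -> nat) (n : 'I_r2 -> nat).
Hypothesis t_ge3 : forall j, (3 <= t j)%N.
Hypothesis n_ge3 : forall j, (3 <= n j)%N.

(* The label [(j, p)] of a semidefinite block, [p] counted from 0, stands for
   the generator whose head is [a^j_{p+1,p+1}]. *)
Definition label : finType := ('I_r1 + {j : 'I_r2 & 'I_(n j - 1)})%type.
Implicit Types a b c : label.

Definition labelS (j : 'I_r2) (p : 'I_(n j - 1)) : label :=
  inr (Tagged (fun j => 'I_(n j - 1)) p).

Definition label_rank a : nat :=
  match a with
  | inl j => j
  | inr u => r1 + (\sum_(k < r2 | (k < tag u)%N) (n k - 1) + tagged u)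
  end.

Definition label_head a : ambient R t n :=
  match a with
  | inl j => aQ R t n j 1 + aQ R t n j 2
  | inr u => aS R t n (tag u) (tagged u).+1 (tagged u).+1
  end.

(** With [p] the position in the block, the minimum gives [a_{p+1,p+3}] inside the block and
    [a_{n-1,n}] at the last label [p = n - 2], which leads to the next block, if any. *)
Definition label_tail a : ambient R t n :=
  match a with
  | inl j => aQ R t n j 3
  | inr u => aS R t n (tag u) (tagged u).+1
               (minn (tagged u).+2 (n (tag u)).-1).+1
  end.

(** On the semidefinite part the rank is the standard enumeration of a disjoint union, which yields
    bijectivity. *)
Lemma label_rank_inr u : label_rank (inr u) = (r1 + tagnat.rank u)%N.
Proof. by rewrite tagnat.rankEsum. Qed.

Lemma label_rank_inj : injective label_rank.
Proof.
move=> [j|u] [j'|u'].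
- by move/val_inj ->.
- by move=> /= e; have := ltn_ord j; lia.
- by move=> /= e; have := ltn_ord j'; lia.
- rewrite !label_rank_inr => /addnI e; congr inr.
  by apply: tagnat.rank_inj; apply: val_inj.
Qed.

Lemma label_rank_lt a : (label_rank a < r1 + \sum_(j < r2) (n j - 1))%N.
Proof.
case: a => [j|u]; first by rewrite ltn_addr ?ltn_ord.
by rewrite label_rank_inr ltn_add2l ltn_ord.
Qed.

Lemma label_rank_surj k : (k < r1 + \sum_(j < r2) (n j - 1))%N ->
  exists a, label_rank a = k.
Proof.
have [kr1 _|r1k kN] := ltnP k r1; first by exists (inl (Ordinal kr1)).
have k' : (k - r1 < \sum_(j < r2) (n j - 1))%N by lia.
exists (inr (tagnat.sig (Ordinal k'))).
by rewrite label_rank_inr tagnat.sigK subnKC.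
Qed.

Let first_coords j : [/\ 0 < t j, 1 < t j & 2 < t j]%N.
Proof. by have := t_ge3 j; split; lia. Qed.

Lemma head_ge0 a x : prod_cone x -> 0 <= ip (label_head a) x.
Proof.
case=> xQ xS; case: a => [j|[j p]] /=.
  have [t0 t1 t2] := first_coords j.
  rewrite ipDl (ip_aQ _ (Ordinal t0)) (ip_aQ _ (Ordinal t1)).
  by have [] := @lorentz_head_tail _ _ _ (Ordinal t0) (Ordinal t1) (Ordinal t2)
    erefl erefl erefl (xQ j).
have pn : (p < n j)%N by have := ltn_ord p; lia.
rewrite (ip_aS _ (Ordinal pn) (Ordinal pn)) eqxx.
by have [] := psd_diag_offdiag (Ordinal pn) (Ordinal pn) (xS j).
Qed.

Lemma tail_eq0 a x : prod_cone x ->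
  ip (label_head a) x = 0 -> ip (label_tail a) x = 0.
Proof.
case=> xQ xS; case: a => [j|[j p]] /=.
  have [t0 t1 t2] := first_coords j.
  rewrite ipDl (ip_aQ _ (Ordinal t0)) (ip_aQ _ (Ordinal t1)).
  rewrite (ip_aQ _ (Ordinal t2)).
  by have [] := @lorentz_head_tail _ _ _ (Ordinal t0) (Ordinal t1) (Ordinal t2)
    erefl erefl erefl (xQ j).
have pn : (p < n j)%N by have := ltn_ord p; lia.
have qn : (minn p.+2 (n j).-1 < n j)%N by have := n_ge3 j; lia.
rewrite (ip_aS _ (Ordinal pn) (Ordinal pn)) eqxx mulr1n => xpp.
rewrite (ip_aS _ (Ordinal pn) (Ordinal qn)).
have [_ ->] := psd_diag_offdiag (Ordinal pn) (Ordinal qn) (xS j) => //.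
by rewrite mul0rn.
Qed.

(* The point [x] of the Lorentz cone with [x_0 + x_1 = s ^ 2], [x_0 - x_1 = 1]
   and [x_2 = s]. *)
Definition testQ (s : R) (i : nat) : R :=
  match i with
  | 0 => (1 + s ^+ 2) / 2
  | 1 => (s ^+ 2 - 1) / 2
  | 2 => s
  | _ => 0
  end.

(** The outer square of this vector has entry [s ^+ 2] at [(p, p)], and the value [2^-1] makes the
    doubled entry at [(p, q)] equal to [s]. *)
Definition testS (p q : nat) (s : R) (i : nat) : R :=
  if i == p then s else if i == q then 2^-1 else 0.

Lemma testQ_cone j s : prod_cone (pointQ t n j (testQ s)).
Proof.
have [_ t1 t2] := first_coords j.
apply: pointQ_cone => [k|/=|]; first by have [] := first_coords k.
  by nra.
rewrite (bigD1 (Ordinal t1)) //= (bigD1 (Ordinal t2)) //= big1 => [|i].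
  (* Equality holds: the point lies on the boundary of the cone. *)
  by rewrite le_eqVlt; apply/orP; left; apply/eqP; field.
by case: i => -[|[|[|i]]] //= _; rewrite expr0n.
Qed.

Lemma test_point a s : exists x : ambient R t n,
  [/\ prod_cone x, ip (label_head a) x = s ^+ 2, ip (label_tail a) x = s,
      forall c, (label_rank c < label_rank a)%N ->
        ip (label_head c) x = 0 /\ ip (label_tail c) x = 0 &
      forall c, label_rank c = (label_rank a).+1 -> ip (label_head c) x = 0].
Proof.
have Np k (p : 'I_(n k - 1)) : (p < n k)%N by have := ltn_ord p; lia.
have Nq k (p : 'I_(n k - 1)) : (minn p.+2 (n k).-1 < n k)%N.
  by have := n_ge3 k; lia.
case: a => [j|[j p]].
  exists (pointQ t n j (testQ s)); have [t0 t1 t2] := first_coords j; split.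
  - exact: testQ_cone.
  - by rewrite /= ipDl !ip_aQ_pointQ // eqxx /=; field.
  - by rewrite /= ip_aQ_pointQ // eqxx.
  - move=> [j'|[j' p']] /=; last by rewrite !ip_aS_pointQ.
    move=> j'j; have [t0' t1' t2'] := first_coords j'.
    rewrite ipDl !ip_aQ_pointQ //.
    by case: eqP j'j => [->|_]; rewrite ?ltnn ?addr0.
  - move=> [j'|[j' p']] /=; last by rewrite !ip_aS_pointQ.
    move=> j'j; have [t0' t1' t2'] := first_coords j'.
    rewrite ipDl !ip_aQ_pointQ //.
    by case: eqP j'j => [->|_]; rewrite ?addr0 //; lia.
set q := minn p.+2 (n j).-1; have pq : p <> q :> nat.
  by have := ltn_ord p; rewrite /q; lia.
exists (pointS t n j (testS p q s)); split.
- by apply: pointS_cone => k; have [] := first_coords k.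
- by rewrite /= ip_aS_pointS // !eqxx /testS eqxx.
- rewrite /= ip_aS_pointS // -/q eqxx /testS !eqxx.
  move/eqP: pq => /negPf pq; by rewrite pq eq_sym pq; field.
- move=> [j'|[j' p']].
    have [t0' t1' t2'] := first_coords j'.
    by rewrite /= ipDl !ip_aQ_pointS ?addr0.
  rewrite /= !ip_aS_pointS //; case: eqP => // jj.
  case: _ / (esym jj) p' => p' lt_pp.
  have pp : (p' < p)%N by lia.
  (* As [p' < p < q], row [p'] of the test matrix is zero, which kills head and tail alike. *)
  suff -> : testS p q s p' = 0 by rewrite !mul0r !mul0rn.
  by rewrite /testS !ifF //; apply/eqP; rewrite /q; have := ltn_ord p; lia.
- move=> [j'|[j' p']].
    have [t0' t1' t2'] := first_coords j'.
    by rewrite /= ipDl !ip_aQ_pointS ?addr0.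
  rewrite /= !ip_aS_pointS //; case: eqP => // jj.
  case: _ / (esym jj) p' => p' lt_pp.
  have pp : p' = p.+1 :> nat by lia.
  (* A next label in the same block forces [q = p + 2], so [p' = p + 1] lies strictly between [p]
     and [q]. *)
  suff -> : testS p q s p' = 0 by rewrite !mul0r !mul0rn.
  by rewrite /testS !ifF //; apply/eqP; rewrite /q; have := ltn_ord p'; lia.
Qed.

Notation G := (link label_rank label_head label_tail).

Let n1_gt0 j : (0 < n j - 1)%N. Proof. by have := n_ge3 j; lia. Qed.

Definition label0 (j : 'I_r2) : label := labelS (Ordinal (n1_gt0 j)).

Lemma sum_before_succ (j' j : 'I_r2) (F : 'I_r2 -> nat) : j = j'.+1 :> nat ->
  (\sum_(k < r2 | (k < j)%N) F k = \sum_(k < r2 | (k < j')%N) F k + F j')%N.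
Proof.
move=> jj; rewrite (bigD1 j') /=; last by rewrite jj.
rewrite addnC; congr (_ + _)%N; apply: eq_bigl => k.
by rewrite jj ltnS ltn_neqAle andbC.
Qed.

Lemma label_rank0 (j : 'I_r2) : j = 0%N :> nat -> label_rank (label0 j) = r1.
Proof. by move=> j0; rewrite /= big_pred0 //= ?addn0 // => k; lia. Qed.

Lemma label_rank0S (j' j : 'I_r2) (p : 'I_(n j' - 1)) :
    j = j'.+1 :> nat -> p.+2 = n j' ->
  label_rank (label0 j) = (label_rank (labelS p)).+1.
Proof.
by move=> jj pn; rewrite /= (sum_before_succ _ jj) /=; lia.
Qed.

(** [GenQ1] and [GenS1] give the link of rank 0; every other constructor pairs a label with its
    predecessor, [GenQS] and [GenSS] at the first label of a semidefinite block. *)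
Lemma generatorP v : generator v <-> exists b, v = G b.
Proof.
have first := @link_first _ _ _ _ _ _ label_rank label_head label_tail.
have next := @link_next _ _ _ _ _ _ _ label_rank_inj label_head label_tail.
split.
- case=> [j j0|j' j jj|j' j jr j0|j r10 j0|j' j jj|j i /andP[i1 ij]].
  + by exists (inl j); rewrite first.
  + by exists (inl j); rewrite (next (inl j')) //= addrC.
  + by exists (label0 j); rewrite (next (inl j')) ?label_rank0 //= addrC.
  + by exists (label0 j); rewrite first ?label_rank0.
  + have p : (n j' - 2 < n j' - 1)%N by have := n_ge3 j'; lia.
    exists (label0 j); rewrite (next (labelS (Ordinal p))); last first.
      by apply: label_rank0S => //=; have := n_ge3 j'; lia.
    rewrite addrC /=; congr (_ + aS _ _ _ _ _ _); have := n_ge3 j'; lia.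
  (* [i] counts from 1: the head belongs to label [i - 1], the tail to its predecessor [i - 2]. *)
  + have [p q] : (i - 2 < n j - 1)%N /\ (i - 1 < n j - 1)%N by lia.
    exists (labelS (Ordinal q)).
    rewrite (next (labelS (Ordinal p))); last first.
      by rewrite /=; lia.
    by rewrite /=; congr (aS _ _ _ _ _ _ + aS _ _ _ _ _ _); lia.
- case=> -[j|[j p]] ->.
    have [j0|j0] := posnP j; first by rewrite first //; exact: GenQ1.
    have lt : (j.-1 < r1)%N by have := ltn_ord j; lia.
    rewrite (next (inl (Ordinal lt))) /= ?prednK // addrC.
    by apply: GenQ; rewrite /= prednK.
  have [p0|p0] := posnP p; last first.
    have lt : (p.-1 < n j - 1)%N by have := ltn_ord p; lia.
    rewrite (next (labelS (Ordinal lt))); last first.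
      by rewrite /=; lia.
    have := @GenS R r1 r2 t n j p.+1; rewrite /=.
    have -> : minn p.-1.+2 (n j).-1 = p.+1 by have := ltn_ord p; lia.
    rewrite [(p.+1 - 1)%N]subn1 /= prednK //; apply; have := ltn_ord p; lia.
  rewrite -/(labelS p); have -> : labelS p = label0 j.
    by rewrite /label0; congr labelS; apply: val_inj.
  have [j0|j0] := posnP j; last first.
    have lt : (j.-1 < r2)%N by have := ltn_ord j; lia.
    set j' := Ordinal lt; have jj : j = j'.+1 :> nat by rewrite /= prednK.
    have q : (n j' - 2 < n j' - 1)%N by have := n_ge3 j'; lia.
    rewrite (next (labelS (Ordinal q))); last first.
      by apply: label_rank0S => //=; have := n_ge3 j'; lia.
    rewrite addrC /=; have := GenSS R t n jj.
    congr (generator (aS _ _ _ _ _ _ + _));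
      have := n_ge3 j'; lia.
  have [r0|r0] := posnP r1.
    by rewrite first ?label_rank0 //; exact: GenS1.
  have lt : (r1.-1 < r1)%N by lia.
  rewrite (next (inl (Ordinal lt))) ?label_rank0 ?prednK //= addrC.
  by apply: GenQS => //=; rewrite prednK.
Qed.

Lemma span_generatorP d : lin_span (@generator R r1 r2 t n) d <->
  exists al : label -> R, d = \sum_a al a *: G a.
Proof.
split=> [[k [al [v [gen_v ->]]]]|[al ->]].
  (* Choose a label for each vector of the combination, then add up the coefficients that share a
     label. *)
  have /boolp.choice[f fE] : forall i, exists b, v i = G b.
    by move=> i; apply/generatorP.
  exists (fun b => \sum_(i | f i == b) al i).
  rewrite (partition_big f predT) //=; apply: eq_bigr => b _.
  by rewrite scaler_suml; apply: eq_bigr => i /eqP <-; rewrite fE.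
exists #|label|, (fun i => al (enum_val i)), (fun i => G (enum_val i)); split.
  by move=> i; apply/generatorP; exists (enum_val i).
by rewrite (reindex _ (onW_bij _ (@enum_val_bij label))).
Qed.

End Generators.

(** * Application of the chain to the given problem *)

Theorem proposition24 (R : realType) (r1 r2 : nat)
    (t : 'I_r1 -> nat) (n : 'I_r2 -> nat)
    (r_gt0 : (0 < r1 + r2)%N)
    (t_ge3 : forall j : 'I_r1, (3 <= t j)%N)
    (n_ge3 : forall j : 'I_r2, (3 <= n j)%N)
    (P : dual_problem R t n) (L : set (ambient R t n))
    (c_eq0 : dp_c P = 0)
    (rangeL : range (dp_Astar P) = L)
    (L_perp : perp L = lin_span (@generator R r1 r2 t n)) :
  is_singularity_degree P (r1 + \sum_(j < r2) (n j - 1))%N.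
Proof.
apply: (@chain_singularity_degree _ _ _ _ _ P c_eq0 _ _ (label_rank (n := n))).
- exact: label_rank_inj.
- exact: label_rank_lt.
- exact: label_rank_surj.
(* The kernel of [dp_A] is the orthogonal complement of [L], hence the span of the generators. *)
- by move=> d; rewrite dp_kerP rangeL L_perp; exact: span_generatorP.
- exact: head_ge0.
- exact: tail_eq0.
- exact: test_point.
Qed.
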